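(* Let $\mathcal X\subset\mathbb R^{d_x}$ and $\mathcal Y\subset\mathbb R^{d_y}$ be nonempty convex compact sets and let $\mathbf A^{(1)},\dots,\mathbf A^{(T)}\in\mathbb R^{d_x\times d_y}$ define a sequence of $T$ bilinear saddle-point problems $\min_{x\in\mathcal X}\max_{y\in\mathcal Y}x^\top\mathbf A^{(t)}y$. Let $L:=\max_{1\le t\le T}\|\mathbf A^{(t)}\|_2$ (spectral norm). Suppose that in each game $t$ both players run optimistic gradient descent (OGD) for $m$ iterations with learning rate $\eta:=\frac{1}{4L}$, and with initialization, for $t\ge 2$, $x^{(t,0)}:=\frac{1}{t-1}\sum_{s<t}\mathring x^{(s)}$ and $y^{(t,0)}:=\frac{1}{t-1}\sum_{s<t}\mathring y^{(s)}$, where $\mathring x^{(s)},\mathring y^{(s)}$ are the players' optimum-in-hindsight strategies in game $s$. Let $\bar x^{(t)}:=\frac1m\sum_{i=1}^m x^{(t,i)}$ and $\bar y^{(t)}:=\frac1m\sum_{i=1}^m y^{(t,i)}$. Then $$\frac1T\sum_{t=1}^T\mathrm{DualGap}^{(t)}(\bar x^{(t)},\bar y^{(t)})\le\frac{2L}{m}\left(V_x^2+V_y^2\right)+\frac{8L(1+\log T)}{mT}\left(\Omega_{\mathcal X}^2+\Omega_{\mathcal Y}^2\right).$$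
   Context: OGD in game $t$, started at $(x^{(t,0)},y^{(t,0)})\in\mathcal X\times\mathcal Y$: put $\hat x^{(t,0)}=x^{(t,0)}$, $\hat y^{(t,0)}=y^{(t,0)}$, and for $i=1,\dots,m$ $x^{(t,i)}=\mathrm{Proj}_{\mathcal X}(\hat x^{(t,i-1)}-\eta\mathbf A^{(t)}y^{(t,i-1)})$, $\hat x^{(t,i)}=\mathrm{Proj}_{\mathcal X}(\hat x^{(t,i-1)}-\eta\mathbf A^{(t)}y^{(t,i)})$, $y^{(t,i)}=\mathrm{Proj}_{\mathcal Y}(\hat y^{(t,i-1)}+\eta(\mathbf A^{(t)})^\top x^{(t,i-1)})$, $\hat y^{(t,i)}=\mathrm{Proj}_{\mathcal Y}(\hat y^{(t,i-1)}+\eta(\mathbf A^{(t)})^\top x^{(t,i)})$, where $\mathrm{Proj}$ is Euclidean projection. In game $1$, $x^{(1,0)}=\arg\min_{x\in\mathcal X}\frac12\|x\|_2^2$ and $y^{(1,0)}=\arg\min_{y\in\mathcal Y}\frac12\|y\|_2^2$. The optimum-in-hindsight strategies are $\mathring x^{(t)}\in\arg\min_{x\in\mathcal X}\sum_{i=1}^m x^\top\mathbf A^{(t)}y^{(t,i)}$ and $\mathring y^{(t)}\in\arg\max_{y\in\mathcal Y}\sum_{i=1}^m (x^{(t,i)})^\top\mathbf A^{(t)}y$, ties broken by a fixed rule. Task similarities: $V_x^2:=\frac1T\min_{x\in\mathcal X}\sum_{t=1}^T\|\mathring x^{(t)}-x\|_2^2$, $V_y^2:=\frac1T\min_{y\in\mathcal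 Y}\sum_{t=1}^T\|\mathring y^{(t)}-y\|_2^2$. $\Omega_{\mathcal X},\Omega_{\mathcal Y}$ are the $\ell_2$-diameters. Duality gap: $\mathrm{DualGap}^{(t)}(\hat x,\hat y):=\max_{y\in\mathcal Y}\hat x^\top\mathbf A^{(t)}y-\min_{x\in\mathcal X}x^\top\mathbf A^{(t)}\hat y$. $\log$ is the natural logarithm. *)

(* Defs.v *)
(* Vectors of R^d are column matrices, with the product topology. *)
From mathcomp Require Import all_boot all_order all_algebra.
From mathcomp Require Import all_classical all_reals all_analysis.

Set Implicit Arguments.
Unset Strict Implicit.
Unset Printing Implicit Defensive.

Import Order.TTheory GRing.Theory Num.Theory.
Import numFieldNormedType.Exports.

Local Open Scope classical_set_scope.
Local Open Scope ring_scope.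

(* The library's norm `|v| on matrices is the sup norm. *)
Definition l2norm (R : realType) (d : nat) (v : 'cV[R]_d) : R :=
  Num.sqrt (\sum_(i < d) v i 0 ^+ 2).

Definition spectral_norm (R : realType) (p q : nat) (A : 'M[R]_(p, q)) : R :=
  sup [set l2norm (A *m v) | v in [set v : 'cV[R]_q | l2norm v <= 1]].

(* Games are numbered from 1; the default 0 is harmless, norms being >= 0. *)
Definition max_spectral_norm (R : realType) (p q T : nat)
    (A : nat -> 'M[R]_(p, q)) : R :=
  \big[Num.max/0]_(1 <= t < T.+1) spectral_norm (A t).

Definition diameter (R : realType) (d : nat) (X : set 'cV[R]_d) : R :=
  sup [set l2norm (p.1 - p.2) | p in X `*` X].

Definition argmin (R : realType) (U : Type) (X : set U) (f : U -> R) : set U :=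
  [set u | X u /\ forall v, X v -> f u <= f v].

Definition argmax (R : realType) (U : Type) (X : set U) (f : U -> R) : set U :=
  [set u | X u /\ forall v, X v -> f v <= f u].

(* On a nonempty closed convex X the minimizer exists and is unique, so the
   default value z is never used. *)
Definition proj (R : realType) (d : nat) (X : set 'cV[R]_d) (z : 'cV[R]_d) :
    'cV[R]_d :=
  xget z (argmin X (fun p => l2norm (p - z))).

Definition payoff (R : realType) (dx dy : nat) (A : 'M[R]_(dx, dy))
    (x : 'cV[R]_dx) (y : 'cV[R]_dy) : R :=
  (x^T *m A *m y) 0 0.

(* Continuous functions on nonempty compact sets: here and in [similarity2] the
   sup is a max and the inf is a min. *)
Definition dual_gap (R : realType) (dx dy : nat) (X : set 'cV[R]_dx)
    (Y : set 'cV[R]_dy) (A : 'M[R]_(dx, dy)) (x : 'cV[R]_dx) (y : 'cV[R]_dy) :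
    R :=
  sup [set payoff A x y' | y' in Y] - inf [set payoff A x' y | x' in X].

(* V^2, the squared task similarity of the strategies xo 1, ..., xo T. *)
Definition similarity2 (R : realType) (d : nat) (X : set 'cV[R]_d) (T : nat)
    (xo : nat -> 'cV[R]_d) : R :=
  T%:R^-1 *
  inf [set \sum_(1 <= t < T.+1) l2norm (xo t - x) ^+ 2 | x in X].

(* x i, y i are the strategies played at iteration i (started at x 0, y 0), and
   xh i, yh i the secondary (hatted) iterates. *)
Definition ogd (R : realType) (dx dy : nat) (X : set 'cV[R]_dx)
    (Y : set 'cV[R]_dy) (A : 'M[R]_(dx, dy)) (eta : R) (m : nat)
    (x xh : nat -> 'cV[R]_dx) (y yh : nat -> 'cV[R]_dy) : Prop :=
  [/\ xh 0%N = x 0%N, yh 0%N = y 0%N &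
      forall i, (i < m)%N ->
        [/\ x i.+1 = proj X (xh i - eta *: (A *m y i)),
            xh i.+1 = proj X (xh i - eta *: (A *m y i.+1)),
            y i.+1 = proj Y (yh i + eta *: (A^T *m x i)) &
            yh i.+1 = proj Y (yh i + eta *: (A^T *m x i.+1))]].

Definition hindsight_x (R : realType) (dx dy : nat) (X : set 'cV[R]_dx)
    (A : 'M[R]_(dx, dy)) (m : nat) (y : nat -> 'cV[R]_dy) : set 'cV[R]_dx :=
  argmin X (fun x => \sum_(1 <= i < m.+1) payoff A x (y i)).

Definition hindsight_y (R : realType) (dx dy : nat) (Y : set 'cV[R]_dy)
    (A : 'M[R]_(dx, dy)) (m : nat) (x : nat -> 'cV[R]_dx) : set 'cV[R]_dy :=
  argmax Y (fun y => \sum_(1 <= i < m.+1) payoff A (x i) y).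

Definition average (R : realType) (d n : nat) (x : nat -> 'cV[R]_d) :
    'cV[R]_d :=
  n%:R^-1 *: \sum_(1 <= i < n.+1) x i.

(* Main.v *)
(* In one game, the variational inequality of the Euclidean projection bounds
   the regret of an optimistic step by a telescoping distance to the comparator,
   plus the squared prediction error, minus the squared lengths of the two moves
   within the step.  With eta = 1 / (4 L) the prediction errors of each player
   are absorbed by the negative terms of the other, so the sum of the two
   regrets, which is m times the duality gap of the averages, is at most
   1 / (2 eta) = 2 L times the squared distances from the initial points to the
   optima in hindsight.  Across games, the initialization is follow-the-leader on
   the losses |xo t - c|^2, whose regret against any fixed c is at most
   (1 + 1/2 + ... + 1/T) diameter^2 <= (1 + ln T) diameter^2. *)
Require Import Defs.
From mathcomp Require Import all_boot all_order all_algebra.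
From mathcomp Require Import all_classical all_reals all_analysis.
From mathcomp Require Import ring lra.

Import Order.TTheory GRing.Theory Num.Theory.
Import numFieldNormedType.Exports.

Local Open Scope classical_set_scope.
Local Open Scope ring_scope.

(** * Euclidean inner product and norm of column vectors *)

Definition dot {R : realType} {d : nat} (u v : 'cV[R]_d) : R :=
  \sum_(i < d) u i 0 * v i 0.

Section Dot.
Context {R : realType} {d : nat}.
Implicit Types (u v w : 'cV[R]_d) (a : R).

Lemma dotC u v : dot u v = dot v u.
Proof. by apply: eq_bigr => i _; rewrite mulrC. Qed.

Lemma dotDl u v w : dot (u + v) w = dot u w + dot v w.
Proof. by rewrite -big_split; apply: eq_bigr => i _; rewrite mxE mulrDl. Qed.

Lemma dotZl a u w : dot (a *: u) w = a * dot u w.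
Proof. by rewrite mulr_sumr; apply: eq_bigr => i _; rewrite mxE mulrA. Qed.

Lemma dotNl u w : dot (- u) w = - dot u w.
Proof. by rewrite -scaleN1r dotZl mulN1r. Qed.

Lemma dotDr u v w : dot w (u + v) = dot w u + dot w v.
Proof. by rewrite dotC dotDl !(dotC w). Qed.

Lemma dotZr a u w : dot w (a *: u) = a * dot w u.
Proof. by rewrite dotC dotZl (dotC w). Qed.

Lemma dotNr u w : dot w (- u) = - dot w u.
Proof. by rewrite dotC dotNl (dotC w). Qed.

Lemma dot0l w : dot 0 w = 0.
Proof. by rewrite -(scale0r 0) dotZl mul0r. Qed.

Definition dotE := (dotDl, dotNl, dotZl, dotDr, dotNr, dotZr).

Lemma dot_suml I (r : seq I) (P : pred I) (F : I -> 'cV[R]_d) w :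
  dot (\sum_(i <- r | P i) F i) w = \sum_(i <- r | P i) dot (F i) w.
Proof.
apply: (big_morph (fun u => dot u w)) => [u v|]; first exact: dotDl.
exact: dot0l.
Qed.

Lemma dot_ge0 u : 0 <= dot u u.
Proof. by apply: sumr_ge0 => i _; rewrite -expr2 sqr_ge0. Qed.

Lemma dot_eq0 u : dot u u = 0 -> u = 0.
Proof.
move=> u0; apply/colP => i; rewrite mxE; apply/eqP.
move/eqP: u0; rewrite psumr_eq0; last by move=> j _; rewrite -expr2 sqr_ge0.
by move=> /allP/(_ i (mem_index_enum i)); rewrite /= mulf_eq0 orbb.
Qed.

Lemma l2norm_ge0 u : 0 <= l2norm u.
Proof. exact: sqrtr_ge0. Qed.

Lemma l2norm_sq u : l2norm u ^+ 2 = dot u u.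
Proof.
rewrite sqr_sqrtr; last by apply: sumr_ge0 => i _; rewrite sqr_ge0.
by apply: eq_bigr => i _; rewrite expr2.
Qed.

Lemma l2normE u : l2norm u = Num.sqrt (dot u u).
Proof. by rewrite -l2norm_sq sqrtr_sqr ger0_norm ?l2norm_ge0. Qed.

Lemma l2normZ a u : l2norm (a *: u) = `|a| * l2norm u.
Proof.
by rewrite !l2normE !dotE mulrA -expr2 sqrtrM ?sqr_ge0// sqrtr_sqr.
Qed.

(** Expanding [|(v.v) u - (u.v) v|^2 >= 0] gives [v.v] times the desired difference. *)
Lemma CauchySchwarz_dot u v : dot u v ^+ 2 <= dot u u * dot v v.
Proof.
have [v0|v0] := eqVneq (dot v v) 0.
  by rewrite v0 (dot_eq0 _ v0) dotC dot0l expr0n mulr0.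
have vp : 0 < dot v v by rewrite lt_neqAle eq_sym v0 dot_ge0.
have := dot_ge0 (dot v v *: u - dot u v *: v).
rewrite !dotE (dotC v u) => h.
have {}h : 0 <= dot v v * (dot u u * dot v v - dot u v ^+ 2).
  by apply: le_trans h _; rewrite le_eqVlt; apply/orP; left; apply/eqP; ring.
by rewrite pmulr_rge0 ?subr_ge0 in h.
Qed.

Lemma l2normB_continuous w : continuous (fun u => l2norm (u - w)).
Proof.
move=> u; apply: (@continuous_comp _ _ _
  (fun u => \sum_(i < d) (u - w) i 0 ^+ 2) Num.sqrt); last exact: sqrt_continuous.
apply: continuous_big => [|i _ {}u]; first exact: add_continuous.
apply: (@continuous_comp _ _ _ (fun v => (v - w) i 0)
  (fun r => r ^+ 2)); last exact: exprn_continuous.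
rewrite (_ : (fun v => (v - w) i 0) = fun v => v i 0 - w i 0); last first.
  by apply/funext => v; rewrite !mxE.
apply: (@continuousB _ _ _ (fun v : 'cV[R]_d => v i 0) (fun=> w i 0)).
  exact: coord_continuous.
exact: cst_continuous.
Qed.

End Dot.

(** * Euclidean projection and one optimistic step *)

Section Projection.
Context {R : realType} {d : nat} (X : set 'cV[R]_d).
Hypotheses (X_neq0 : X !=set0) (X_convex : convex_set X).
Hypothesis X_compact : compact X.
Implicit Types (u v z p : 'cV[R]_d).

Lemma convex_segment {u v} k : X u -> X v -> 0 <= k -> k <= 1 ->
  X (k *: u + (1 - k) *: v).
Proof.
move=> /mem_set Xu /mem_set Xv k0 k1.
by have /set_mem := X_convex _ _ (Itv01 k0 k1) Xu Xv.
Qed.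

Lemma projP z : argmin X (fun p => l2norm (p - z)) (Defs.proj X z).
Proof.
have lc : {within X, continuous (fun p => l2norm (p - z))}.
  exact/continuous_subspaceT/l2normB_continuous.
apply: xgetPex; have [c /set_mem Xc cmin] := compact_EVT_min X_neq0 X_compact lc.
by exists c; split=> // v Xv; apply: cmin; exact: mem_set.
Qed.

Lemma projX z : X (Defs.proj X z).
Proof. by case: (projP z). Qed.

(** Along the segment from the projection to [v], the squared distance to [z] is a quadratic in the
    step [k], minimal at [k = 0]; its slope there, twice this product, is therefore nonnegative. *)
Lemma proj_dot_ge0 z v : X v -> 0 <= dot (Defs.proj X z - z) (v - Defs.proj X z).
Proof.
have [Xp pmin] := projP z; move: (Defs.proj X z) Xp pmin => p Xp pmin Xv.
have quad k : 0 <= k -> k <= 1 ->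
    0 <= k * (2 * dot (p - z) (v - p) + k * dot (v - p) (v - p)).
  move=> k0 k1; have := pmin _ (convex_segment k Xv Xp k0 k1).
  rewrite !l2normE ler_sqrt ?dot_ge0// -subr_ge0 => /le_trans; apply.
  rewrite le_eqVlt; apply/orP; left; apply/eqP; rewrite !dotE.
  by rewrite (dotC z p) (dotC v p) (dotC z v); ring.
have := dot_ge0 (v - p); move: (dot (v - p) _) (dot (p - z) _) quad => N c quad N0.
rewrite leNgt; apply/negP => c0.
(* any k in ]0, 1] with k N < - 2 c contradicts [quad] *)
have Nc : 0 < N - c by lra.
have kp : 0 < - c / (N - c) by rewrite divr_gt0// oppr_gt0.
have := quad (- c / (N - c)) (ltW kp).
rewrite ler_pdivrMr// mul1r => /(_ ltac:(lra)).
rewrite pmulr_rge0//; apply/negP; rewrite -ltNge.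
have -> : 2 * c + - c / (N - c) * N = c * (N - 2 * c) / (N - c).
  by field; rewrite gt_eqF.
by rewrite pmulr_llt0 ?invr_gt0// nmulr_rlt0//; lra.
Qed.

(* With prediction s and loss s', both scaled by the learning rate. *)
Lemma optimistic_step a s s' u x h : X u ->
    x = Defs.proj X (a - s) -> h = Defs.proj X (a - s') ->
  2 * dot s' (x - u) <=
    dot (a - u) (a - u) - dot (h - u) (h - u) - 1 / 2 * dot (x - h) (x - h)
    - dot (x - a) (x - a) + 2 * dot (s' - s) (s' - s).
Proof.
move=> Xu xE hE; have Xh : X h by rewrite hE; exact: projX.
(* The variational inequality of [h] is tested at [u] and that of [x] at [h], so that the terms
   [|a - h|^2] cancel in the sum. *)
have := proj_dot_ge0 (a - s') _ Xu; have := proj_dot_ge0 (a - s) _ Xh.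
rewrite -xE -hE.
(* Young's inequality [2 <s' - s, x - h> <= 2 |s' - s|^2 + 1/2 |x - h|^2], which spends half of the
   available [- |x - h|^2]. *)
have := dot_ge0 (2 *: (s' - s) - (x - h)).
rewrite !dotE (dotC h s') (dotC h s) (dotC x s') (dotC x s) (dotC s s').
rewrite (dotC h x) (dotC u h) (dotC u a) (dotC x a).
lra.
Qed.

End Projection.

(** * Spectral norm as an operator bound for [A] and its transpose *)

Section SpectralNorm.
Context {R : realType} {p q : nat}.
Implicit Types (A : 'M[R]_(p, q)) (u : 'cV[R]_p) (v : 'cV[R]_q).

(** Cauchy-Schwarz on each row; this shows that the set under the [sup] of [spectral_norm] is
    bounded. *)
Lemma mulmx_frobenius A v :
  dot (A *m v) (A *m v) <= \sum_i dot (row i A)^T (row i A)^T * dot v v.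
Proof.
apply: ler_sum => i _; rewrite -expr2.
have -> : (A *m v) i 0 = dot (row i A)^T v.
  by rewrite mxE; apply: eq_bigr => j _; rewrite !mxE.
exact: CauchySchwarz_dot.
Qed.

Lemma spectral_norm_bound A v : l2norm v <= 1 -> l2norm (A *m v) <= spectral_norm A.
Proof.
move=> v1; apply: ub_le_sup; last by exists v.
exists (Num.sqrt (\sum_i dot (row i A)^T (row i A)^T)) => _ [w /= w1 <-].
rewrite l2normE ler_sqrt; last by apply: sumr_ge0 => i _; exact: dot_ge0.
apply: le_trans (mulmx_frobenius A w) _; apply: ler_sum => i _.
rewrite ler_piMr ?dot_ge0//.
by rewrite -l2norm_sq expr_le1 ?l2norm_ge0.
Qed.

Lemma spectral_norm_ge0 A : 0 <= spectral_norm A.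
Proof.
apply: le_trans (spectral_norm_bound A 0 _); first exact: l2norm_ge0.
by rewrite -(scale0r 0) l2normZ normr0 mul0r.
Qed.

Lemma spectral_normP A v :
  dot (A *m v) (A *m v) <= spectral_norm A ^+ 2 * dot v v.
Proof.
have [v0|v0] := eqVneq (dot v v) 0.
  by rewrite (dot_eq0 _ v0) mulmx0 !dot0l mulr0.
have vp : 0 < l2norm v by rewrite l2normE sqrtr_gt0 lt_neqAle eq_sym v0 dot_ge0.
have := spectral_norm_bound A ((l2norm v)^-1 *: v).
rewrite l2normZ normfV gtr0_norm// mulVf ?gt_eqF// => /(_ (lexx _)).
rewrite -scalemxAr l2normZ normfV gtr0_norm// mulrC ler_pdivrMr// => h.
rewrite -!l2norm_sq -exprMn ler_sqr ?nnegrE ?l2norm_ge0//.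
by rewrite mulr_ge0 ?spectral_norm_ge0 ?l2norm_ge0.
Qed.

Lemma payoffE A u v : payoff A u v = dot u (A *m v).
Proof. by rewrite /payoff -mulmxA mxE; apply: eq_bigr => i _; rewrite mxE. Qed.

Lemma payoffET A u v : payoff A u v = dot (A^T *m u) v.
Proof.
rewrite /payoff mxE; apply: eq_bigr => i _; congr (_ * _).
by rewrite -[u in RHS]trmxK -trmx_mul [RHS]mxE.
Qed.

(** Duality: for [w = A^T u], [|w|^2 = <u, A w>] is at most [|u|] times the norm of [A] times
    [|w|]. *)
Lemma spectral_norm_trmxP A u :
  dot (A^T *m u) (A^T *m u) <= spectral_norm A ^+ 2 * dot u u.
Proof.
set w := A^T *m u.
have [w0|w0] := eqVneq (dot w w) 0.
  by rewrite w0 mulr_ge0 ?sqr_ge0 ?dot_ge0.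
have wp : 0 < dot w w by rewrite lt_neqAle eq_sym w0 dot_ge0.
have wE : dot w w = dot u (A *m w) by rewrite -payoffET payoffE.
rewrite -(ler_pM2r wp) -expr2 {1}wE.
apply: le_trans (CauchySchwarz_dot _ _) _.
by rewrite mulrAC [leRHS]mulrC ler_wpM2l ?dot_ge0// spectral_normP.
Qed.

End SpectralNorm.

(** * Running averages and follow-the-leader *)

Section Average.
Context {R : realType} {d : nat}.
Implicit Types (u v w c : 'cV[R]_d) (z : nat -> 'cV[R]_d).

Lemma dist_sq_le u v w :
  dot (u - v) (u - v) <= 2 * dot (u - w) (u - w) + 2 * dot (v - w) (v - w).
Proof.
have := dot_ge0 ((u - w) + (v - w)).
rewrite !dotE (dotC v u) (dotC w u) (dotC w v); lra.
Qed.

Lemma averageS z n : (0 < n)%N ->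
  average n.+1 z = average n z + n.+1%:R^-1 *: (z n.+1 - average n z).
Proof.
move=> n0; rewrite /average big_nat_recr//= scalerDr scalerBr addrA addrAC.
congr (_ + _); rewrite scalerA -scalerBl; congr (_ *: _).
have n0R : n%:R != 0 :> R by rewrite pnatr_eq0 -lt0n.
by rewrite -natr1; field; rewrite n0R natr1 pnatr_eq0.
Qed.

Lemma average1 z : average 1 z = z 1%N.
Proof. by rewrite /average big_nat1 invr1 scale1r. Qed.

(** The new average is [(1 - r) a + r y] with [r = 1 / (n + 1)]; this is [|(1 - r) a + r y - c|^2 =
    (1 - r) |a - c|^2 + r |y - c|^2 - r (1 - r) |y - a|^2] times [n + 1]. *)
Lemma averageS_dist z c n : (0 < n)%N ->
  n.+1%:R * dot (average n.+1 z - c) (average n.+1 z - c) =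
  n%:R * dot (average n z - c) (average n z - c)
  + dot (z n.+1 - c) (z n.+1 - c)
  - (1 - n.+1%:R^-1) * dot (z n.+1 - average n z) (z n.+1 - average n z).
Proof.
move=> n0; rewrite averageS//; move: (average n z) (z _) => a y.
have n1 : n.+1%:R != 0 :> R by rewrite pnatr_eq0.
rewrite !dotE (dotC y a) (dotC c a) (dotC c y) -[n%:R](addrK 1) natr1.
by field.
Qed.

(** Jensen's inequality for the squared distance: the subtracted term of [averageS_dist] is dropped
    at each induction step. *)
Lemma average_dist_le z c n : (0 < n)%N ->
  n%:R * dot (average n z - c) (average n z - c) <=
    \sum_(1 <= t < n.+1) dot (z t - c) (z t - c).
Proof.
elim: n => // -[|n] IH _; first by rewrite big_nat1 average1 mul1r.
rewrite averageS_dist// big_nat_recr//=.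
apply: le_trans (lerD (IH isT) (lexx _)); rewrite gerBl.
by rewrite mulr_ge0 ?dot_ge0// subr_ge0 invf_le1 ?ler1n ?ltr0n.
Qed.

(** This is [ln (1 + r) <= r] at [r = - 1 / (n + 1)]; it turns harmonic terms into a telescoping
    logarithm. *)
Lemma ler_inv_ln_diff n : (0 < n)%N ->
  n.+1%:R^-1 <= ln n.+1%:R - ln n%:R :> R.
Proof.
move=> n0; have n1 : 0 < n.+1%:R :> R by rewrite ltr0n.
have nR : 0 < n%:R :> R by rewrite ltr0n.
have nE : 1 + - n.+1%:R^-1 = n%:R / n.+1%:R :> R.
  by rewrite -[n%:R](addrK 1) natr1; field; rewrite gt_eqF.
have := @le_ln1Dx R (- n.+1%:R^-1).
rewrite nE ln_div ?posrE// ltrN2 invf_lt1 ?ltr1n// => /(_ n0).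
by rewrite lerNr opprB.
Qed.

(* Follow-the-leader on the squared losses c |-> |z t - c|^2; keeping the term in
   [average n z - c] makes the induction exact up to D / n per step. *)
Lemma average_prediction_le z c (D : R) n : (0 < n)%N ->
    (forall s t, (1 <= s <= n)%N -> (1 <= t <= n)%N ->
      dot (z s - z t) (z s - z t) <= D) ->
  \sum_(2 <= t < n.+1) dot (z t - average t.-1 z) (z t - average t.-1 z)
    + n%:R * dot (average n z - c) (average n z - c) <=
  \sum_(1 <= t < n.+1) dot (z t - c) (z t - c) + D * ln n%:R.
Proof.
elim: n => // -[|n] IH _ zD.
  by rewrite big_geq// big_nat1 average1 ln1; lra.
have D0 : 0 <= D by apply: le_trans (dot_ge0 _) (zD 1%N 1%N isT isT).
have /(IH isT) {}IH s t : (1 <= s <= n.+1)%N -> (1 <= t <= n.+1)%N ->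
    dot (z s - z t) (z s - z t) <= D.
  by move=> /andP[s1 sn] /andP[t1 tn]; apply: zD; rewrite ?s1 ?t1 leqW.
rewrite averageS_dist// !(big_nat_recr n.+2)//=.
(* By Jensen, the average of points within squared distance [D] of [z n.+2] is itself within [D] of
   it. *)
have zaD : dot (z n.+2 - average n.+1 z) (z n.+2 - average n.+1 z) <= D.
  have n1 : 0 < n.+1%:R :> R by rewrite ltr0n.
  rewrite -opprB -scaleN1r dotZl dotZr mulrA mulrNN !mul1r -(ler_pM2l n1).
  apply: le_trans (average_dist_le _ _ _ _) _ => //.
  rewrite mulr_natl -[n.+1 in leRHS]subn0 -sumr_const_nat big_add1/=.
  rewrite big_nat [leRHS]big_nat; apply: ler_sum => i /andP[_ im].
  by apply: zD; rewrite ?leqnn//= leqW.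
(* After [averageS_dist], the new prediction error survives only with weight [1 / (n + 2)], so it
   costs at most [D / (n + 2)], which the increment of [D * ln] pays for. *)
have := ler_wpM2l D0 (ler_inv_ln_diff n.+1 isT).
have : n.+2%:R^-1 * dot (z n.+2 - average n.+1 z) (z n.+2 - average n.+1 z)
    <= n.+2%:R^-1 * D by rewrite ler_wpM2l// invr_ge0.
move: IH; rewrite /= mulrBr mulrBl mul1r (mulrC D _^-1).
move: (D * ln _) (D * ln _) => l1 l2.
move: (n.+2%:R^-1 * D) (n.+2%:R^-1 * dot _ _) (n.+1%:R * dot _ _) => e f g.
lra.
Qed.
End Average.

(** * Diameter of a compact set and cost of the initializations *)

Section Diameter.
Context {R : realType} {d : nat} (X : set 'cV[R]_d).
Hypothesis X_compact : compact X.

Lemma diameterP u v : X u -> X v -> dot (u - v) (u - v) <= diameter X ^+ 2.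
Proof.
move=> Xu Xv; suff uvD : l2norm (u - v) <= diameter X.
  rewrite -l2norm_sq ler_sqr ?nnegrE ?l2norm_ge0//.
  exact: le_trans (l2norm_ge0 _) uvD.
apply: ub_le_sup; last by exists (u, v).
have lc : {within X, continuous (fun p => l2norm (p - 0))}.
  exact/continuous_subspaceT/l2normB_continuous.
have X0 : X !=set0 by exists u.
have [c _ cmax] := compact_EVT_max X0 X_compact lc.
(* With [c] a point of [X] of largest norm, no two points of [X] are further apart than twice that
   norm. *)
exists (2 * l2norm (c - 0)) => _ [[p q] /= [Xp Xq] <-].
rewrite -(@ler_sqr R) ?nnegrE ?mulr_ge0 ?l2norm_ge0// exprMn !l2norm_sq.
have sq w : X w -> dot (w - 0) (w - 0) <= dot (c - 0) (c - 0).
  by move=> /mem_set/cmax; rewrite -!l2norm_sq ler_sqr ?nnegrE ?l2norm_ge0.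
have := dist_sq_le p q 0; move: (sq p Xp) (sq q Xq); lra.
Qed.

(** From game 2 on, follow-the-leader against an arbitrary [c] in [X] gives the logarithm, and the
    infimum over [c] gives the similarity. Game 1 has no past to average: its error is bounded by
    one squared diameter, the [1] in [1 + ln T]. *)
Lemma warm_start_error (T : nat) (z z0 : nat -> 'cV[R]_d) : (0 < T)%N ->
    (forall t, (1 <= t <= T)%N -> X (z t)) -> X (z0 1%N) ->
    (forall t, (2 <= t <= T)%N -> z0 t = average t.-1 z) ->
  \sum_(1 <= t < T.+1) dot (z t - z0 t) (z t - z0 t) <=
    T%:R * similarity2 X T z + diameter X ^+ 2 * (1 + ln T%:R).
Proof.
move=> T0 Xz Xz01 z0E; rewrite /similarity2 mulrA divff ?pnatr_eq0 -?lt0n// mul1r.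
rewrite -lerBlDr; apply: lb_le_inf.
  by exists (\sum_(1 <= t < T.+1) l2norm (z t - z0 1%N) ^+ 2), (z0 1%N).
move=> _ [c Xc <-]; rewrite lerBlDr.
under [in leRHS]eq_bigr do rewrite l2norm_sq.
have zD s t : (1 <= s <= T)%N -> (1 <= t <= T)%N ->
    dot (z s - z t) (z s - z t) <= diameter X ^+ 2.
  by move=> /Xz Xs /Xz Xt; exact: diameterP.
have := average_prediction_le z c _ _ T0 zD.
have -> : \sum_(2 <= t < T.+1) dot (z t - average t.-1 z) (z t - average t.-1 z)
    = \sum_(2 <= t < T.+1) dot (z t - z0 t) (z t - z0 t).
  by apply: eq_big_nat => t tT; rewrite z0E.
have := mulr_ge0 (ler0n R T) (dot_ge0 (average T z - c)).
have := diameterP _ _ (Xz 1%N T0) Xz01.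
rewrite [\sum_(1 <= t < _) dot (z t - z0 t) _]big_ltn ?ltnS// mulrDr mulr1.
move: (_ * ln _) (_ * dot _ _) => l e; lra.
Qed.

End Diameter.

(** * Regret and duality gap of OGD within one game *)

Section OptimisticGradientDescent.
Context {R : realType} {dx dy : nat} (X : set 'cV[R]_dx) (Y : set 'cV[R]_dy).
Hypotheses (X_neq0 : X !=set0) (X_convex : convex_set X) (X_compact : compact X).
Hypotheses (Y_neq0 : Y !=set0) (Y_convex : convex_set Y) (Y_compact : compact Y).
Context (A : 'M[R]_(dx, dy)) (L eta : R) (m : nat).
Context (x xh : nat -> 'cV[R]_dx) (y yh : nat -> 'cV[R]_dy).
Hypothesis run : ogd X Y A eta m x xh y yh.
Hypotheses (AL : spectral_norm A <= L).
Implicit Types (u : 'cV[R]_dx) (v : 'cV[R]_dy).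

Let L_ge0 : 0 <= L := le_trans (spectral_norm_ge0 A) AL.

Let A_le v : dot (A *m v) (A *m v) <= L ^+ 2 * dot v v.
Proof.
apply: le_trans (spectral_normP _ _) _.
by rewrite ler_wpM2r ?dot_ge0// ler_sqr ?nnegrE ?spectral_norm_ge0.
Qed.

Let AT_le u : dot (A^T *m u) (A^T *m u) <= L ^+ 2 * dot u u.
Proof.
apply: le_trans (spectral_norm_trmxP _ _) _.
by rewrite ler_wpM2r ?dot_ge0// ler_sqr ?nnegrE ?spectral_norm_ge0.
Qed.

(** The left side is at most [2 (eta L)^2 |w - w'|^2 <= 1/8 |w - w'|^2], which is then split through
    [w'']. With [w''] the opponent's hatted iterate, both pieces match negative terms of the
    opponent's own bound. *)
Lemma prediction_error_le d d' (B : 'M[R]_(d', d)) (w w' w'' : 'cV[R]_d) :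
    (forall w, dot (B *m w) (B *m w) <= L ^+ 2 * dot w w) ->
    16 * (eta * L) ^+ 2 <= 1 ->
  2 * dot (eta *: (B *m w) - eta *: (B *m w')) (eta *: (B *m w) - eta *: (B *m w'))
  <= 1 / 4 * dot (w - w'') (w - w'') + 1 / 4 * dot (w' - w'') (w' - w'').
Proof.
move=> BL etaL; rewrite -scalerBr -mulmxBr dotZl dotZr.
have := dist_sq_le w w' w''; have := ler_wpM2l (sqr_ge0 eta) (BL (w - w')).
have := ler_wpM2r (dot_ge0 (w - w')) etaL.
move: (dot (B *m _) _) (dot (w - w') _) (dot (w - w'') _) => a b c.
rewrite (_ : eta ^+ 2 * (L ^+ 2 * b) = (eta * L) ^+ 2 * b); last by ring.
rewrite (_ : eta * (eta * a) = eta ^+ 2 * a); last by ring.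
rewrite -(mulrA 16); move: ((eta * L) ^+ 2 * b) (eta ^+ 2 * a) => e f; lra.
Qed.

(** The two trailing negative terms are part of the induction invariant: at iteration [k + 1] they
    absorb the halves of the prediction errors measured from [x k] and [y k]; the other halves are
    absorbed by the moves from [xh k] to [x k.+1] and from [yh k] to [y k.+1]. *)
Lemma ogd_regret u v k : X u -> Y v -> 16 * (eta * L) ^+ 2 <= 1 -> (k <= m)%N ->
  2 * eta * \sum_(1 <= i < k.+1) (payoff A (x i) v - payoff A u (y i)) <=
    dot (x 0%N - u) (x 0%N - u) - dot (xh k - u) (xh k - u)
    + dot (y 0%N - v) (y 0%N - v) - dot (yh k - v) (yh k - v)
    - 1 / 2 * dot (x k - xh k) (x k - xh k)
    - 1 / 2 * dot (y k - yh k) (y k - yh k).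
Proof.
case: run => xh0 yh0 step Xu Yv etaL; elim: k => [|k IH] km.
  by rewrite big_geq// xh0 yh0 !subrr !dot0l; lra.
have {}IH := IH (ltnW km); case: (step k km) => xE xhE yE yhE.
rewrite big_nat_recr//= mulrDr.
have := optimistic_step X X_neq0 X_convex X_compact _ _ _ _ _ _ Xu xE xhE.
(* The maximizer descends on minus the payoff, hence the double negation that brings its step to the
   form of [optimistic_step]. *)
have {}yE : y k.+1 = Defs.proj Y (yh k - - (eta *: (A^T *m x k))).
  by rewrite opprK.
have {}yhE : yh k.+1 = Defs.proj Y (yh k - - (eta *: (A^T *m x k.+1))).
  by rewrite opprK.
have := optimistic_step Y Y_neq0 Y_convex Y_compact _ _ _ _ _ _ Yv yE yhE.
(* The payoff of the pair [x k.+1], [y k.+1] enters the two regrets with opposite signs and cancels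
   in their sum. *)
have -> : dot (eta *: (A *m y k.+1)) (x k.+1 - u) =
    eta * (payoff A (x k.+1) (y k.+1) - payoff A u (y k.+1)).
  by rewrite dotZl dotC !dotE !payoffE.
have -> : dot (- (eta *: (A^T *m x k.+1))) (y k.+1 - v) =
    eta * (payoff A (x k.+1) v - payoff A (x k.+1) (y k.+1)).
  by rewrite !dotE !payoffET; ring.
have := prediction_error_le _ _ A (y k.+1) (y k) (yh k) A_le etaL.
have := prediction_error_le _ _ A^T (x k.+1) (x k) (xh k) AT_le etaL.
have opp_sq d (w w' : 'cV[R]_d) : dot (- w - - w') (- w - - w') = dot (w - w') (w - w').
  by rewrite -opprD !dotE; lra.
rewrite opp_sq.
have := dot_ge0 (x k.+1 - xh k); have := dot_ge0 (y k.+1 - yh k).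
have := dot_ge0 (x k - xh k); have := dot_ge0 (y k - yh k).
move: IH; lra.
Qed.

Lemma ogd_dual_gap u v : (0 < m)%N -> eta = 1 / (4 * L) ->
    hindsight_x X A m y u -> hindsight_y Y A m x v ->
  dual_gap X Y A (average m x) (average m y) <=
    2 * L / m%:R * (dot (u - x 0%N) (u - x 0%N) + dot (v - y 0%N) (v - y 0%N)).
Proof.
move=> m0 etaE [Xu umin] [Yv vmax].
have mR : 0 < m%:R :> R by rewrite ltr0n.
have payoff_avgl v' : payoff A (average m x) v' =
    m%:R^-1 * \sum_(1 <= i < m.+1) payoff A (x i) v'.
  rewrite payoffE dotZl dot_suml; congr (_ * _).
  by apply: eq_bigr => i _; rewrite payoffE.
have payoff_avgr u' : payoff A u' (average m y) =
    m%:R^-1 * \sum_(1 <= i < m.+1) payoff A u' (y i).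
  rewrite payoffET dotC dotZl dot_suml; congr (_ * _).
  by apply: eq_bigr => i _; rewrite dotC payoffET.
(* By bilinearity, the payoffs of an average are averages of payoffs, so the optima in hindsight [u]
   and [v] bound the infimum and the supremum. *)
have gap : dual_gap X Y A (average m x) (average m y) <=
    m%:R^-1 * \sum_(1 <= i < m.+1) (payoff A (x i) v - payoff A u (y i)).
  rewrite sumrB mulrBr; apply: lerB.
    apply: ge_sup; first by case: Y_neq0 => w Yw; exists (payoff A (average m x) w), w.
    move=> _ [w Yw <-]; rewrite payoff_avgl.
    apply: ler_wpM2l; [by rewrite invr_ge0 ltW|exact: vmax].
  apply: lb_le_inf; first by case: X_neq0 => w Xw; exists (payoff A w (average m y)), w.
  move=> _ [w Xw <-]; rewrite payoff_avgr.
  apply: ler_wpM2l; [by rewrite invr_ge0 ltW|exact: umin].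
apply: le_trans gap _; rewrite [2 * L / _]mulrC -mulrA.
apply: ler_wpM2l; first by rewrite invr_ge0 ltW.
(* If [L = 0], then [eta = 1 / 0] is [0] by convention and the regret bound carries no information;
   but then [A] acts as zero and all payoffs vanish. *)
have [L0|L0] := eqVneq L 0.
  rewrite L0 mulr0 mul0r big1// => i _; rewrite !payoffE.
  have A0 (w : 'cV[R]_dy) : A *m w = 0.
    apply: dot_eq0; apply/eqP; rewrite eq_le dot_ge0 andbT.
    by apply: le_trans (A_le w) _; rewrite L0 expr0n mul0r.
  by rewrite !A0 !(dotC _ 0) !dot0l subrr.
have Lp : 0 < L by rewrite lt_neqAle eq_sym L0 L_ge0.
have etaL : eta * L = 1 / 4 by rewrite etaE; field.
have := ogd_regret u v m Xu Yv; rewrite etaL => /(_ _ (leqnn m)).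
have -> : 16 * (1 / 4) ^+ 2 <= 1 :> R by lra.
(* Multiplication by [L] turns the factor [2 * eta] of the regret into [2 * (1 / 4)], by which the
   goal is scaled below. *)
move=> /(_ isT) /(ler_wpM2l (ltW Lp)).
rewrite mulrA [L * _]mulrCA (mulrC L) etaL.
have sqC d (w w' : 'cV[R]_d) : dot (w - w') (w - w') = dot (w' - w) (w' - w).
  by rewrite !dotE; lra.
rewrite (sqC _ u) (sqC _ v).
move=> /le_trans h; rewrite -(@ler_pM2l _ (2 * (1 / 4))); last by lra.
apply: h; set Q := (X in L * X).
have QP : Q <= dot (x 0%N - u) (x 0%N - u) + dot (y 0%N - v) (y 0%N - v).
  rewrite /Q; move: (dot_ge0 (x m - xh m)) (dot_ge0 (y m - yh m)).
  move: (dot_ge0 (xh m - u)) (dot_ge0 (yh m - v)); lra.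
apply: le_trans (ler_wpM2l L_ge0 QP) _.
by rewrite le_eqVlt; apply/orP; left; apply/eqP; field.
Qed.

End OptimisticGradientDescent.

(** * Average duality gap over the sequence of games *)

Theorem corollaryC2 (R : realType) (dx dy T m : nat)
    (T_gt0 : (0 < T)%N) (m_gt0 : (0 < m)%N)
    (X : set 'cV[R]_dx) (Y : set 'cV[R]_dy)
    (X_neq0 : X !=set0) (X_convex : convex_set X) (X_compact : compact X)
    (Y_neq0 : Y !=set0) (Y_convex : convex_set Y) (Y_compact : compact Y)
    (A : nat -> 'M[R]_(dx, dy))
    (L eta : R)
    (L_def : L = max_spectral_norm T A)
    (eta_def : eta = 1 / (4 * L))
    (x xh : nat -> nat -> 'cV[R]_dx) (y yh : nat -> nat -> 'cV[R]_dy)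
    (xo : nat -> 'cV[R]_dx) (yo : nat -> 'cV[R]_dy)
    (run_ogd : forall t, (1 <= t <= T)%N ->
       ogd X Y (A t) eta m (x t) (xh t) (y t) (yh t))
    (xo_opt : forall t, (1 <= t <= T)%N -> hindsight_x X (A t) m (y t) (xo t))
    (yo_opt : forall t, (1 <= t <= T)%N -> hindsight_y Y (A t) m (x t) (yo t))
    (x_init1 : argmin X (fun u => 1 / 2 * l2norm u ^+ 2) (x 1%N 0%N))
    (y_init1 : argmin Y (fun v => 1 / 2 * l2norm v ^+ 2) (y 1%N 0%N))
    (x_init : forall t, (2 <= t <= T)%N -> x t 0%N = average t.-1 xo)
    (y_init : forall t, (2 <= t <= T)%N -> y t 0%N = average t.-1 yo) :
  1 / T%:R * \sum_(1 <= t < T.+1)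
    dual_gap X Y (A t) (average m (x t)) (average m (y t))
  <= 2 * L / m%:R * (similarity2 X T xo + similarity2 Y T yo)
     + 8 * L * (1 + ln T%:R) / (m%:R * T%:R)
       * (diameter X ^+ 2 + diameter Y ^+ 2).
Proof.
have AL t : (1 <= t <= T)%N -> spectral_norm (A t) <= L.
  by move=> tT; rewrite L_def /max_spectral_norm;
    apply: (le_bigmax_seq 0 t xpredT (fun t => spectral_norm (A t)));
    rewrite ?mem_index_iota.
have L_ge0 : 0 <= L := le_trans (spectral_norm_ge0 _) (AL 1%N T_gt0).
have x_err := warm_start_error X X_compact T xo (fun t => x t 0%N) T_gt0
  (fun t tT => proj1 (xo_opt t tT)) (proj1 x_init1) x_init.
have y_err := warm_start_error Y Y_compact T yo (fun t => y t 0%N) T_gt0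
  (fun t tT => proj1 (yo_opt t tT)) (proj1 y_init1) y_init.
have TR : 0 < T%:R :> R by rewrite ltr0n.
have mR : 0 < m%:R :> R by rewrite ltr0n.
have lnT : 0 <= ln T%:R :> R by rewrite ln_ge0// ler1n.
have gaps : \sum_(1 <= t < T.+1)
      dual_gap X Y (A t) (average m (x t)) (average m (y t)) <=
    2 * L / m%:R * (\sum_(1 <= t < T.+1) dot (xo t - x t 0%N) (xo t - x t 0%N)
      + \sum_(1 <= t < T.+1) dot (yo t - y t 0%N) (yo t - y t 0%N)).
  rewrite -big_split/= mulr_sumr big_nat [leRHS]big_nat.
  apply: ler_sum => t tT.
  exact: (ogd_dual_gap X Y X_neq0 X_convex X_compact Y_neq0 Y_convex Y_compact
    _ _ _ _ _ _ _ _ (run_ogd t tT) (AL t tT) _ _ m_gt0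
    eta_def (xo_opt t tT) (yo_opt t tT)).
have c_ge0 : 0 <= 2 * L / m%:R by apply: divr_ge0; [exact: mulr_ge0|exact: ltW].
rewrite div1r mulrC ler_pdivrMr//; apply: le_trans gaps _.
apply: le_trans (ler_wpM2l c_ge0 (lerD x_err y_err)) _.
set O := diameter X ^+ 2 + diameter Y ^+ 2.
have O_ge0 : 0 <= O by rewrite addr_ge0 ?sqr_ge0.
(* The argument yields the constant [2] where [8] is claimed; the difference is three times the
   diameter term obtained. *)
have slack : 0 <= 3 * (2 * L / m%:R * ((1 + ln T%:R) * O)).
  by rewrite !mulr_ge0// addr_ge0.
rewrite -subr_ge0; apply: le_trans slack _; rewrite le_eqVlt; apply/orP; left.
by apply/eqP; rewrite /O; field; rewrite !gt_eqF.
Qed.
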